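(* Fix $\nu\in(0,1)$ and $\pi\in\Lambda$. Assume that the noise random variables $\xi_1,\ldots,\xi_n$ are independent and sub-Gaussian with variance proxy $\sigma^2>0$. Then for any $\beta\ge \frac{2\sigma^2}{\min(\nu,1-\nu)}$ and any $\delta\in(0,1)$, the $Q$-aggregate estimator $\mathsf{f}_{\tilde\lambda}$ (where $\tilde\lambda\in\operatorname{argmin}_{\lambda\in\Lambda}Q(\lambda)$) satisfies $$\operatorname{MSE}(\mathsf{f}_{\tilde\lambda})\le\min_{1\le j\le M}\Big\{\operatorname{MSE}(f_j)+\frac{\beta}{n}\log\Big(\frac{\rho(1)}{\pi_j\delta}\Big)\Big\}$$ with probability $1-\delta$ (i.e. at least $1-\delta$). Moreover, $$\mathbb{E}\operatorname{MSE}(\mathsf{f}_{\tilde\lambda})\le\min_{1\le j\le M}\Big\{\operatorname{MSE}(f_j)+\frac{\beta}{n}\log\Big(\frac{\rho(1)}{\pi_j}\Big)\Big\}.$$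
   Context: Fixed design regression: $x_1,\ldots,x_n$ are given points of a set $\mathcal{X}$, $f_1,\ldots,f_M:\mathcal{X}\to\mathbb{R}$ are given functions (the dictionary), $\eta:\mathcal{X}\to\mathbb{R}$ is an unknown function, and one observes $Y_i=\eta(x_i)+\xi_i$, $i=1,\ldots,n$. The random vector $\xi=(\xi_1,\ldots,\xi_n)^\top$ is sub-Gaussian with variance proxy $\sigma^2$ if $\mathbb{E}[e^{t^\top\xi}]\le e^{\sigma^2|t|_2^2/2}$ for all $t\in\mathbb{R}^n$ ($|\cdot|_2$ is the Euclidean norm). For $f:\mathcal{X}\to\mathbb{R}$: $\operatorname{MSE}(f)=\frac1n\sum_{i=1}^n(\eta(x_i)-f(x_i))^2$ and $\widehat{\operatorname{MSE}}(f)=\frac1n\sum_{i=1}^n(Y_i-f(x_i))^2$. $\Lambda=\{\lambda\in\mathbb{R}^M:\lambda_j\ge0,\ \sum_{j=1}^M\lambda_j=1\}$ and $\mathsf{f}_\lambda=\sum_{j=1}^M\lambda_jf_j$. $\rho:[0,1]\to\mathbb{R}$ is a fixed function such that $\rho(t)\ge t$ for all $t$ and $t\mapsto t\log\rho(t)$ is convex; $\mathcal{K}_\rho(\lambda,\pi)=\sum_{j=1}^M\lambda_j\log\big(\rho(\lambda_j)/\pi_j\big)$, where terms with $\lambda_j=0$ are taken to be $0$ and terms with $\lambda_j>0=\pi_j$ are $+\infty$; likewise $\log(\rho(1)/\pi_j)=\log(\rho(1)/(\pi_j\delta))=+\infty$ if $\pi_j=0$. For $\lambda\in\Lambda$, $$Q(\lambda)=(1-\nu)\widehat{\operatorname{MSE}}(\mathsf{f}_\lambda)+\nu\sum_{j=1}^M\lambda_j\widehat{\operatorname{MSE}}(f_j)+\frac{\beta}{n}\mathcal{K}_\rho(\lambda,\pi).$$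 The minimizer $\tilde\lambda$ is a (measurable) function of the data $Y_1,\ldots,Y_n$. *)

(* Defs.v *)
From HB Require Import structures.
From mathcomp Require Import all_boot all_order all_algebra.
From mathcomp Require Import all_classical all_reals all_analysis.

Set Implicit Arguments.
Unset Strict Implicit.
Unset Printing Implicit Defensive.

Import Order.TTheory GRing.Theory Num.Theory.
Import numFieldNormedType.Exports.

#[global] Open Scope classical_set_scope.
#[global] Open Scope ring_scope.

Definition argmin (T : Type) (R : realType) (A : set T) (F : T -> \bar R) :
    set T :=
  [set a | A a /\ forall b, A b -> (F a <= F b)%E].

Definition mutually_independent d (T : measurableType d) (R : realType)
    (P : probability T R) (I : finType) (X : I -> {RV P >-> R}) : Prop :=
  forall (J : {set I}) (A : I -> set R), (forall i, measurable (A i)) ->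
    P (\bigcap_(i in [set` J]) (X i @^-1` A i)) =
    (\prod_(i in J) P (X i @^-1` A i))%E.

(* [v] is the variance proxy, i.e. sigma ^+ 2. *)
Definition sub_gaussian d (T : measurableType d) (R : realType)
    (P : probability T R) (k : nat) (X : 'I_k -> {RV P >-> R}) (v : R) : Prop :=
  forall t : 'I_k -> R,
    ('E_P[(fun w => expR (\sum_(i < k) t i * X i w))] <=
     (expR (v * (\sum_(i < k) t i ^+ 2) / 2))%:E)%E.

Definition simplex (R : realType) (M : nat) : set (M.-tuple R) :=
  [set lam | (forall j, 0 <= tnth lam j) /\ \sum_(j < M) tnth lam j = 1].

Definition mixture (R : realType) (X : Type) (M : nat) (f : 'I_M -> X -> R)
    (lam : M.-tuple R) : X -> R :=
  fun z => \sum_(j < M) tnth lam j * f j z.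

Definition MSE (R : realType) (X : Type) (n : nat) (x : 'I_n -> X)
    (eta f : X -> R) : R :=
  n%:R^-1 * \sum_(i < n) (eta (x i) - f (x i)) ^+ 2.

Definition MSE_hat (R : realType) (X : Type) (n : nat) (x : 'I_n -> X)
    (y : n.-tuple R) (f : X -> R) : R :=
  n%:R^-1 * \sum_(i < n) (tnth y i - f (x i)) ^+ 2.

(* In [\bar R] one has [0 * z = 0], [0^-1 = +oo] and [lne +oo = +oo], so a term
   with [lam_j = 0] vanishes and, when [rho t >= t], a term with
   [lam_j > 0 = pi_j] is [+oo]. *)
Definition K_rho (R : realType) (M : nat) (rho : R -> R)
    (lam pi : M.-tuple R) : \bar R :=
  (\sum_(j < M)
    (tnth lam j)%:E * lne ((rho (tnth lam j))%:E / (tnth pi j)%:E))%E.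

Definition Q (R : realType) (X : Type) (n M : nat) (x : 'I_n -> X)
    (f : 'I_M -> X -> R) (rho : R -> R) (pi : M.-tuple R) (nu beta : R)
    (y : n.-tuple R) (lam : M.-tuple R) : \bar R :=
  (((1 - nu) * MSE_hat x y (mixture f lam)
    + nu * \sum_(j < M) tnth lam j * MSE_hat x y (f j))%:E
   + (beta / n%:R)%:E * K_rho rho lam pi)%E.

Definition observations d (T : measurableType d) (R : realType)
    (P : probability T R) (X : Type) (n : nat) (x : 'I_n -> X) (eta : X -> R)
    (xi : 'I_n -> {RV P >-> R}) (w : T) : n.-tuple R :=
  [tuple eta (x i) + xi i w | i < n].

(* Main.v *)
Require Import Defs.
From mathcomp Require Import all_boot all_order all_algebra.
From mathcomp Require Import all_classical all_reals all_analysis.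
From mathcomp Require Import measurable_realfun ring lra.

(** The bound is deterministic up to one random variable of expectation at
    most 1.

    Fix an index [k] with [pi_k > 0], and write [a_j] for the vector of values
    of [f_j] at the design points and [d_j = a_j - a_k]. On the segment from
    the minimizer [lam] to the vertex [e_k] the quadratic part of [Q] has
    curvature [(1 - nu) * MSE x (mixture f lam) (f k)], and the penalty is
    convex. Comparing [lam] with a point close to it on this segment therefore
    improves [Q lam <= Q e_k] by that curvature term ([argmin_first_order]).

    Expanding the squares with [Y = eta + xi], the curvature term and the part
    of [Q] weighted by [nu] together dominate
    [min(nu, 1 - nu) * \sum_j lam_j |d_j|^2] ([pointwise_contrast]). This is
    the offset that compensates the noise: the excess risk of [lam] over [f_k]
    is at most [beta / n * ln (rho 1 / pi_k)] plus [1 / n] times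
      [\sum_j lam_j U_j - beta * \sum_j lam_j ln (lam_j / pi_j)],
    where [U_j = 2 <xi, d_j> - min(nu, 1 - nu) * |d_j|^2] is the [contrast];
    replacing [rho lam_j] by [lam_j] is allowed as [rho t >= t]. By the
    variational formula for the entropy this does not exceed [beta * ln S]
    with [S = \sum_j pi_j exp (U_j / beta)] ([gibbs_variational]). The weights
    [lam], which depend on the noise, have disappeared ([oracle_inequality]).

    Independence makes [xi] sub-Gaussian as a vector ([sub_gaussian_indep]), so
    [E exp (U_j / beta) <= 1] as soon as
    [2 sigma^2 <= beta * min(nu, 1 - nu)], whence [E S <= 1]
    ([expectation_exp_contrast_le1]). Markov's inequality applied to [S] gives
    the bound in probability, and [ln S <= S - 1] the bound in expectation.
    The minimum over [k] is over deterministic quantities, so it costs no union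
    bound: it suffices to treat one [k] that attains it. *)

Set Implicit Arguments.
Unset Strict Implicit.
Unset Printing Implicit Defensive.

Import Order.TTheory GRing.Theory Num.Theory.
Import numFieldNormedType.Exports.

(** * Expectation of a product of independent variables *)

Section independent_product.
Local Open Scope ereal_scope.
Import HBNNSimple.

(** An identity tested on indicators extends to nonnegative functions: by
    linearity to simple functions, then by monotone convergence. [c] is
    [E F] in the application; its finiteness makes [c * _] continuous. *)
Lemma integral_mul_comp (d : measure_display) (T : measurableType d)
    (R : realType) (P : {measure set T -> \bar R}) (F X : T -> R) (c : \bar R) :
  c \is a fin_num ->
  measurable_fun setT F -> measurable_fun setT X ->
  (forall w, 0 <= F w)%R ->
  (forall A : set R, measurable A ->
    \int[P]_w (F w * \1_A (X w))%:E = c * \int[P]_w (\1_A (X w))%:E) ->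
  forall g : R -> R, measurable_fun setT g -> (forall y, 0 <= g y)%R ->
    \int[P]_w (F w * g (X w))%:E = c * \int[P]_w (g (X w))%:E.
Proof.
move=> cfin mF mX F0 ind g mg g0.
have simple (h : {nnsfun R >-> R}) :
    \int[P]_w (F w * h (X w))%:E = c * \int[P]_w (h (X w))%:E.
  pose s : seq R := finmap.enum_fset (fset_set (range h)).
  have hE y : h y = (\sum_(r <- s) r * \1_(h @^-1` [set r]) y)%R.
    by rewrite {1}fimfunE /= fsbig_finite.
  have s0 r : r \in s -> (0 <= r)%R.
    by rewrite in_fset_set// inE => -[y _ <-].
  have mI r : measurable_fun setT
      (fun w => \1_(h @^-1` [set r]) (X w) : R).
    by apply: measurableT_comp => //; exact: measurable_indic.
  (* The norm changes nothing on the range of h, and makes each summand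
     nonnegative whatever the index. *)
  transitivity (\sum_(r <- s)
      \int[P]_w (`|r| * (F w * \1_(h @^-1` [set r]) (X w)))%:E).
    rewrite -ge0_integral_sum//; last 2 first.
    - move=> r; apply/measurable_EFinP; apply: measurable_funM => //.
      exact: measurable_funM.
    - by move=> r w _; rewrite lee_fin !mulr_ge0.
    apply: eq_integral => w _; rewrite hE mulr_sumr sumEFin; congr EFin.
    apply: eq_big_seq => r /s0 r0.
    by rewrite ger0_norm// mulrCA.
  transitivity (\sum_(r <- s)
      c * \int[P]_w (`|r| * \1_(h @^-1` [set r]) (X w))%:E).
    apply: eq_bigr => r _.
    under eq_integral do rewrite EFinM.
    rewrite ge0_integralZl ?lee_fin//; last 2 first.
    - by apply/measurable_EFinP; exact: measurable_funM.
    - by move=> w _; rewrite lee_fin mulr_ge0.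
    rewrite ind// muleCA; congr (_ * _).
    rewrite -ge0_integralZl ?lee_fin//; exact/measurable_EFinP.
  rewrite -ge0_sume_distrr; last first.
    by move=> r _; apply: integral_ge0 => w _; rewrite lee_fin mulr_ge0.
  congr (_ * _); rewrite -ge0_integral_sum//; last first.
    by move=> r; apply/measurable_EFinP; apply: measurable_funM.
  apply: eq_integral => w _; rewrite hE sumEFin; congr EFin.
  by apply: eq_big_seq => r /s0 r0; rewrite ger0_norm.
have mEg : measurable_fun setT (EFin \o g) by exact/measurable_EFinP.
pose h n := nnsfun_approx measurableT mEg n.
have hg y : (h n y)%:E @[n --> \oo] --> (g y)%:E.
  by apply: (cvg_nnsfun_approx measurableT mEg) => // z _; rewrite lee_fin.
have hnd y : {homo (fun n => h n y) : m n / (m <= n)%N >-> (m <= n)%R}.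
  by move=> m n mn; have /lefP := nd_nnsfun_approx measurableT mEg mn; apply.
have mh n : measurable_fun setT (fun w => h n (X w)).
  by apply: measurableT_comp.
have lhs : \int[P]_w (F w * h n (X w))%:E @[n --> \oo] -->
    \int[P]_w (F w * g (X w))%:E.
  rewrite (_ : \int[P]_w (F w * g (X w))%:E =
      \int[P]_w limn (fun n => (F w * h n (X w))%:E)).
    apply: cvg_monotone_convergence => //.
    - by move=> n; apply/measurable_EFinP; exact: measurable_funM.
    - by move=> n w _; rewrite lee_fin mulr_ge0.
    - by move=> w _ m n mn; rewrite lee_fin ler_wpM2l// hnd.
  apply: eq_integral => w _; apply/esym/cvg_lim => //.
  by rewrite EFinM; under eq_fun do rewrite EFinM; exact: cvgeZl.
have rhs : c * \int[P]_w (h n (X w))%:E @[n --> \oo] -->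
    c * \int[P]_w (g (X w))%:E.
  apply: cvgeZl => //.
  rewrite (_ : \int[P]_w (g (X w))%:E =
      \int[P]_w limn (fun n => (h n (X w))%:E)).
    apply: cvg_monotone_convergence => //.
    - by move=> n; exact/measurable_EFinP.
    - by move=> n w _; rewrite lee_fin.
    - by move=> w _ m n mn; rewrite lee_fin hnd.
  by apply: eq_integral => w _; apply/esym/cvg_lim.
have lhsE : (fun n => \int[P]_w (F w * h n (X w))%:E) =
    (fun n => c * \int[P]_w (h n (X w))%:E).
  by apply/funext => n; exact: simple.
by rewrite lhsE in lhs; exact: (cvg_unique _ lhs rhs).
Qed.

(** Independence is the case where every [h i] is an indicator. The other
    factors are replaced one at a time: the set [S] contains the indices whose
    factor is not known to be an indicator, and taking [i] out of [S] amounts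
    to testing the identity on indicators of [X i] only. *)
Lemma integral_prod_comp (d : measure_display) (T : measurableType d)
    (R : realType) (P : probability T R) (I : finType)
    (X : I -> {RV P >-> R}) :
  mutually_independent X ->
  forall h : I -> R -> R,
    (forall i, measurable_fun setT (h i)) -> (forall i y, 0 <= h i y)%R ->
    (forall i, \int[P]_w (h i (X i w))%:E < +oo) ->
    \int[P]_w (\prod_i h i (X i w))%:E =
    \prod_i \int[P]_w (h i (X i w))%:E.
Proof.
move=> indep.
have indicI (A : set R) : measurable A -> forall i,
    \int[P]_w (\1_A (X i w))%:E = P (X i @^-1` A).
  move=> mA i; rewrite -(setIT (X i @^-1` A)) -integral_indic//.
  by rewrite -[_ @^-1` _]setTI; exact: measurable_funP.
suff main (k : nat) (S : {set I}) (h : I -> R -> R) : #|S| = k ->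
    (forall i, i \notin S ->
      exists2 A : set R, measurable A & h i = \1_A :> (R -> R)) ->
    (forall i, measurable_fun setT (h i)) -> (forall i y, 0 <= h i y)%R ->
    (forall i, \int[P]_w (h i (X i w))%:E < +oo) ->
    \int[P]_w (\prod_i h i (X i w))%:E = \prod_i \int[P]_w (h i (X i w))%:E.
  move=> h mh h0 hoo; apply: (main _ [set: I]%SET h erefl) => // i.
  by rewrite finset.in_setT.
elim: k S h => [|k IH] S h Sk hind mh h0 hoo.
  have /choice[A hA] i : exists A : set R, measurable A /\ h i = \1_A :> (R -> R).
    have [|A mA ->] := hind i; last by exists A.
    by move/eqP: Sk; rewrite cards_eq0 => /eqP ->; rewrite finset.in_set0.
  have hE i : h i = \1_(A i) by have [] := hA i.
  have mA i : measurable (A i) by have [] := hA i.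
  have -> : \prod_i \int[P]_w (h i (X i w))%:E =
      \prod_(i in [set: I]%SET) P (X i @^-1` A i).
    by apply: eq_big => [i|i _]; rewrite ?finset.in_setT// hE indicI.
  rewrite -indep//.
  rewrite -[in RHS](setIT (classical_sets.bigcap _ _)) -integral_indic//; last first.
    apply: fin_bigcap_measurable; first exact: finite_finset.
    by move=> i _; rewrite -[_ @^-1` _]setTI; exact: measurable_funP.
  apply: eq_integral => w _; congr EFin.
  rewrite indicE; have [wA|wA] := boolP (w \in _).
    rewrite big1// => i _; rewrite hE indicE.
    move: wA; rewrite inE => /(_ i)/=; rewrite finset.in_setT => /(_ isT) Aw.
    by rewrite mem_set.
  have [i Ai] : exists i, ~ A i (X i w).
    apply/existsNP => Aw; move/negP: wA; apply; rewrite inE => i _.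
    exact: Aw.
  by rewrite (bigD1 i)//= hE indicE memNset ?mul0r.
have [i iS] : exists i, i \in S by apply/set0Pn; rewrite -cards_eq0 Sk.
pose F w := (\prod_(j | j != i) h j (X j w))%R.
pose c := \prod_(j | j != i) \int[P]_w (h j (X j w))%:E.
have mhX j : measurable_fun setT (fun w => h j (X j w)).
  exact: measurableT_comp.
have int_fin j : \int[P]_w (h j (X j w))%:E \is a fin_num.
  by rewrite ge0_fin_numE//; apply: integral_ge0 => w _; rewrite lee_fin.
transitivity (\int[P]_w (F w * h i (X i w))%:E).
  by apply: eq_integral => w _; rewrite (bigD1 i)//= mulrC.
rewrite (bigD1 i)//= muleC -/c.
apply: (integral_mul_comp (X := X i)) => //.
- by apply: prode_fin_num.
- rewrite /F; under eq_fun do rewrite -big_filter.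
  by apply: measurable_prod => j _; exact: mhX.
- by move=> w; apply: prodr_ge0.
- move=> A mA.
  pose h' j := if j == i then \1_A : R -> R else h j.
  have h'i : h' i = \1_A by rewrite /h' eqxx.
  have h'j j : j != i -> h' j = h j by rewrite /h' => /negbTE ->.
  have := IH (S :\ i)%SET h'.
  rewrite (bigD1 i)//= h'i muleC => IH'.
  transitivity (\int[P]_w (\prod_j h' j (X j w))%:E).
    apply: eq_integral => w _; rewrite (bigD1 i)//= h'i mulrC; congr (_ * _)%:E.
    by apply: eq_bigr => j ji; rewrite h'j.
  rewrite IH'.
  + by congr (_ * _); apply: eq_bigr => j ji; rewrite h'j.
  + by move: Sk; rewrite (cardsD1 i) iS add1n => -[].
  + move=> j; rewrite !inE negb_and negbK => /orP[/eqP ->|jS].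
      by exists A.
    have [->|ji] := eqVneq j i; first by exists A.
    by rewrite h'j//; exact: hind.
  + move=> j; have [->|ji] := eqVneq j i; last by rewrite h'j.
    rewrite h'i; exact: measurable_indic.
  + move=> j y; have [->|ji] := eqVneq j i; last by rewrite h'j.
    by rewrite h'i.
  + move=> j; have [->|ji] := eqVneq j i; last by rewrite h'j.
    rewrite h'i indicI// (le_lt_trans (probability_le1 _ _))// ?ltry//.
    by rewrite -[_ @^-1` _]setTI; exact: measurable_funP.
Qed.

End independent_product.

(** * Joint sub-Gaussianity *)

(** The Laplace transform of independent variables factorizes, and the
    exponents [v * t_i ^+ 2 / 2] add up. *)
Lemma sub_gaussian_indep (d : measure_display) (T : measurableType d)
    (R : realType) (P : probability T R) (n : nat)
    (xi : 'I_n -> {RV P >-> R}) (v : R) :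
  mutually_independent xi ->
  (forall i, sub_gaussian (fun _ : 'I_1 => xi i) v) -> sub_gaussian xi v.
Proof.
move=> indep subG t.
have subG1 i : (\int[P]_w (expR (t i * xi i w))%:E <=
    (expR (v * t i ^+ 2 / 2))%:E)%E.
  have := subG i (fun=> t i); rewrite unlock big_ord1.
  by under eq_integral do rewrite big_ord1.
have expf i : measurable_fun setT (fun y : R => expR (t i * y)).
  by apply: measurableT_comp => //; exact: measurable_funM.
pose a i := fine (\int[P]_w (expR (t i * xi i w))%:E).
have aE i : (\int[P]_w (expR (t i * xi i w))%:E = (a i)%:E)%E.
  rewrite fineK// ge0_fin_numE.
    by rewrite (le_lt_trans (subG1 i))// ltry.
  by apply: integral_ge0 => w _; rewrite lee_fin expR_ge0.
rewrite unlock.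
under eq_integral do rewrite expR_sum.
rewrite (integral_prod_comp indep (h := fun i y => expR (t i * y)))//; last first.
  by move=> i; rewrite aE ltry.
under eq_bigr do rewrite aE.
rewrite prodEFin lee_fin mulrAC mulr_sumr expR_sum.
apply: ler_prod => i _; rewrite -!lee_fin -aE.
apply/andP; split.
  by apply: integral_ge0 => w _; rewrite lee_fin expR_ge0.
by rewrite (le_trans (subG1 i))// lee_fin ler_expR; lra.
Qed.

(** * The variational bound for the entropy *)

(** The usual bound [ln (\sum_j pi_j exp u_j)] on the left-hand side, with the
    logarithm linearized at [exp c] by [ln s <= c + exp (- c) * s - 1]. In this
    form the proof is termwise, from [1 + a <= exp a], and the free constant
    serves both a bound in probability and one in expectation. *)
Lemma gibbs_variational (R : realType) (I : finType) (lam pi u : I -> R)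
    (c : R) :
  (forall j, 0 <= lam j) -> \sum_j lam j = 1 -> (forall j, 0 <= pi j) ->
  (forall j, pi j = 0 -> lam j = 0) ->
  \sum_j lam j * (u j - (ln (lam j) - ln (pi j))) <=
  c + expR (- c) * (\sum_j pi j * expR (u j)) - 1.
Proof.
move=> lam0 lam1 pi0 supp.
have -> : c + expR (- c) * (\sum_j pi j * expR (u j)) - 1 =
    \sum_j (expR (- c) * (pi j * expR (u j)) + (c - 1) * lam j).
  by rewrite big_split/= -!mulr_sumr lam1; lra.
apply: ler_sum => j _.
have [l0|l0] := eqVneq (lam j) 0.
  by rewrite l0 mul0r mulr0 addr0 !mulr_ge0// ?expR_ge0.
have lpos : 0 < lam j by rewrite lt_neqAle eq_sym l0 lam0.
have ppos : 0 < pi j.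
  rewrite lt_neqAle eq_sym pi0 andbT; apply/eqP => /supp /eqP.
  by rewrite (negbTE l0).
set a := u j - c - ln (lam j) + ln (pi j).
have ea : expR (- c) * (pi j * expR (u j)) = lam j * expR a.
  rewrite /a !expRD expRN (expRN (ln _)) !lnK ?posrE//.
  by field; rewrite ?gt_eqF// expR_gt0.
have h : lam j * (1 + a) <= lam j * expR a by rewrite ler_pM2l// expR_ge1Dx.
rewrite ea (le_trans _ (lerD h (lexx _)))// /a le_eqVlt; apply/orP; left.
by apply/eqP; ring.
Qed.

(** * The penalty on the simplex *)

Lemma lne_ratio (R : realType) (r p : R) : 0 < r -> 0 < p ->
  lne (r%:E / p%:E)%E = (ln r - ln p)%:E.
Proof.
by move=> r0 p0; rewrite inver gt_eqF// -EFinM lne_EFin ?divr_gt0// ln_div ?posrE.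
Qed.

Section penalty.
Context (R : realType) (M : nat) (rho : R -> R).
Context (rho_ge : forall t : R, 0 <= t <= 1 -> t <= rho t).
Implicit Types (lam pi : M.-tuple R).

Lemma simplex_le1 lam j : simplex lam -> tnth lam j <= 1.
Proof.
by move=> [lam0 <-]; rewrite (bigD1 j)//= lerDl sumr_ge0.
Qed.

(** When [lam_j = 0] both sides vanish whatever the junk values of the
    logarithms. *)
Lemma K_rhoE lam pi : simplex lam -> simplex pi ->
  (forall j, tnth pi j = 0 -> tnth lam j = 0) ->
  K_rho rho lam pi =
  (\sum_(j < M) tnth lam j * (ln (rho (tnth lam j)) - ln (tnth pi j)))%:E.
Proof.
move=> slam spi supp; rewrite /K_rho -sumEFin; apply: eq_bigr => j _.
have [l0|l0] := eqVneq (tnth lam j) 0; first by rewrite l0 mul0e mul0r.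
have lpos : 0 < tnth lam j by rewrite lt_neqAle eq_sym l0 slam.1.
have ppos : 0 < tnth pi j.
  rewrite lt_neqAle eq_sym spi.1 andbT; apply/eqP => /supp /eqP.
  by rewrite (negbTE l0).
have rpos : 0 < rho (tnth lam j).
  by rewrite (lt_le_trans lpos)// rho_ge// ltW//= simplex_le1.
by rewrite lne_ratio.
Qed.

(** An index with [lam_j > 0 = pi_j] contributes [+oo] and no term is [-oo]. *)
Lemma K_rho_fin_supp lam pi : simplex lam -> simplex pi ->
  (K_rho rho lam pi < +oo)%E -> forall j, tnth pi j = 0 -> tnth lam j = 0.
Proof.
move=> slam spi Kfin j pj0; apply/eqP/negP => /negP l0.
have lpos i : tnth lam i != 0 -> 0 < tnth lam i.
  by move=> li; rewrite lt_neqAle eq_sym li slam.1.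
have rpos i : tnth lam i != 0 -> 0 < rho (tnth lam i).
  by move=> /lpos li; rewrite (lt_le_trans li)// rho_ge// ltW//= simplex_le1.
move: Kfin; rewrite ltNge => /negP; apply; rewrite leye_eq; apply/eqP.
apply/esum_eqyP.
  move=> i _.
  have [->|li] := eqVneq (tnth lam i) 0; first by rewrite mul0e.
  have [->|pi0] := eqVneq (tnth pi i) 0.
    by rewrite inve0 gt0_muley ?lte_fin ?rpos//= gt0_muley ?lte_fin ?lpos.
  have ppos : 0 < tnth pi i by rewrite lt_neqAle eq_sym pi0 spi.1.
  by rewrite inver (gt_eqF ppos) -EFinM lne_EFin ?divr_gt0// rpos.
exists j; split => //.
by rewrite pj0 inve0 gt0_muley ?lte_fin ?rpos//= gt0_muley ?lte_fin ?lpos.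
Qed.

End penalty.

(** * Moving a minimizer towards a vertex of the simplex *)

Definition segment (R : realType) (M : nat) (lam : M.-tuple R) (k : 'I_M)
    (t : R) : M.-tuple R :=
  [tuple (1 - t) * tnth lam j + t * (j == k)%:R | j < M].

Lemma tnth_segment (R : realType) (M : nat) (lam : M.-tuple R) (k : 'I_M)
    (t : R) (j : 'I_M) :
  tnth (segment lam k t) j = (1 - t) * tnth lam j + t * (j == k)%:R.
Proof. by rewrite tnth_mktuple. Qed.

Lemma sum_delta (R : realType) (M : nat) (k : 'I_M) (g : 'I_M -> R) :
  \sum_(j < M) (j == k)%:R * g j = g k.
Proof.
rewrite (bigD1 k)//= eqxx mul1r big1 ?addr0// => j /negbTE ->.
by rewrite mul0r.
Qed.

Lemma sum_segment (R : realType) (M : nat) (lam : M.-tuple R) (k : 'I_M)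
    (t : R) (g : 'I_M -> R) :
  \sum_(j < M) tnth (segment lam k t) j * g j =
  (1 - t) * (\sum_(j < M) tnth lam j * g j) + t * g k.
Proof.
rewrite -[in RHS](sum_delta k g) !mulr_sumr -big_split/=.
by apply: eq_bigr => j _; rewrite tnth_segment; ring.
Qed.

Lemma segment_simplex (R : realType) (M : nat) (lam : M.-tuple R) (k : 'I_M)
    (t : R) : 0 <= t <= 1 -> simplex lam -> simplex (segment lam k t).
Proof.
move=> /andP[t0 t1] [lam0 lam1]; split => [j|].
  by rewrite tnth_segment addr_ge0// mulr_ge0// subr_ge0.
under eq_bigr do rewrite -[tnth _ _]mulr1.
rewrite sum_segment; under eq_bigr do rewrite mulr1.
by rewrite lam1; ring.
Qed.

Lemma mixture_segment (R : realType) (X : Type) (M : nat)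
    (f : 'I_M -> X -> R) (lam : M.-tuple R) (k : 'I_M) (t : R) :
  mixture f (segment lam k t) =
  (fun z => (1 - t) * mixture f lam z + t * f k z).
Proof. by apply/funext => z; exact: sum_segment. Qed.

(** The exact defect of convexity of the square; the last term is the
    curvature that [argmin_first_order] keeps. *)
Lemma MSE_hat_segment (R : realType) (X : Type) (n : nat) (x : 'I_n -> X)
    (y : n.-tuple R) (g h : X -> R) (t : R) :
  MSE_hat x y (fun z => (1 - t) * g z + t * h z) =
  (1 - t) * MSE_hat x y g + t * MSE_hat x y h - t * (1 - t) * MSE x g h.
Proof.
rewrite /MSE_hat /MSE; apply/esym.
rewrite ![_ * (_^-1 * _)]mulrCA -mulrDr -mulrBr; congr (_ * _).
rewrite !mulr_sumr -big_split -sumrB; apply: eq_bigr => i _ /=.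
by ring.
Qed.

(** Letting [t] tend to 0, in the form of a finite choice of [t]. *)
Lemma le0_of_le_scale (R : realType) (a b : R) :
  (forall t, 0 < t < 1 -> a <= t * b) -> a <= 0.
Proof.
move=> h; rewrite leNgt; apply/negP => a0.
have ab : a <= 2^-1 * b by apply: h; lra.
have b0 : 0 < b by lra.
(* At t = a / (2 * b) the hypothesis reads a <= a / 2. *)
have : a <= (a / (2 * b)) * b.
  apply: h; rewrite divr_gt0 ?mulr_gt0//= ltr_pdivrMr ?mulr_gt0//; lra.
have -> : a / (2 * b) * b = a / 2 by field; rewrite gt_eqF.
lra.
Qed.

Lemma convex_function_itv01 (R : realType) (phi : R -> R) :
  convex_function (`[0, 1]%classic : set R) phi ->
  forall t a b : R, 0 <= t <= 1 -> 0 <= a <= 1 -> 0 <= b <= 1 ->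
    phi ((1 - t) * a + t * b) <= (1 - t) * phi a + t * phi b.
Proof.
move=> cvx t a b t01 a01 b01.
have mem (z : R) : 0 <= z <= 1 -> z \in (`[0, 1]%classic : set R).
  by move=> z01; rewrite inE/= in_itv.
suff H s : 0 <= s <= 1 ->
    phi (s * a + (1 - s) * b) <= s * phi a + (1 - s) * phi b.
  by have := H (1 - t); rewrite subKr; apply; lra.
move=> /andP[s0 s1].
exact: (cvx (Itv01 s0 s1) a b (mem _ a01) (mem _ b01)).
Qed.

Section optimality.
Context (R : realType) (X : Type) (n M : nat) (x : 'I_n -> X).
Context (f : 'I_M -> X -> R) (rho : R -> R).
Context (rho_ge : forall t : R, 0 <= t <= 1 -> t <= rho t).
Context (rho_convex : convex_function (`[0, 1]%classic : set R)
  (fun t : R => t * ln (rho t))).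
Implicit Types (lam pi : M.-tuple R).

Lemma penalty_segment lam pi k t : 0 <= t <= 1 -> simplex lam ->
  \sum_(j < M) tnth (segment lam k t) j *
    (ln (rho (tnth (segment lam k t) j)) - ln (tnth pi j)) <=
  (1 - t) * (\sum_(j < M) tnth lam j *
    (ln (rho (tnth lam j)) - ln (tnth pi j))) +
  t * (ln (rho 1) - ln (tnth pi k)).
Proof.
move=> /andP[t0 t1] slam.
pose phi (s : R) := s * ln (rho s).
have phi_delta j : phi (j == k)%:R = (j == k)%:R * ln (rho 1).
  by rewrite /phi; case: (j == k); rewrite ?mul0r.
rewrite -[X in _ <= _ + t * X](sum_delta k (fun j => ln (rho 1) - ln (tnth pi j))).
rewrite !mulr_sumr -big_split/=; apply: ler_sum => j _.
rewrite tnth_segment mulrBr.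
have cvx : phi ((1 - t) * tnth lam j + t * (j == k)%:R) <=
    (1 - t) * phi (tnth lam j) + t * phi (j == k)%:R.
  by apply: convex_function_itv01 => //;
    rewrite ?slam.1 ?simplex_le1 ?ler0n ?lern1 ?leq_b1 ?t0.
rewrite phi_delta /phi in cvx.
rewrite (le_trans (lerB cvx (lexx _)))// le_eqVlt; apply/orP; left.
by apply/eqP; ring.
Qed.

(** First-order optimality along the segment to the vertex [k]: the
    comparison of [Q lam] with [Q] at parameter [t] is divided by [t], and the
    curvature term survives in the limit. The support of [lam] lies in that of
    [pi] because [Q] is finite at the vertex. *)
Lemma argmin_first_order pi (nu beta : R) (y : n.-tuple R) lam k :
  0 < beta / n%:R -> simplex pi -> 0 < tnth pi k ->
  argmin (@simplex R M) (Q x f rho pi nu beta y) lam ->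
  (forall j, tnth pi j = 0 -> tnth lam j = 0) /\
  (1 - nu) * MSE_hat x y (mixture f lam)
    + nu * (\sum_(j < M) tnth lam j * MSE_hat x y (f j))
    + beta / n%:R * (\sum_(j < M) tnth lam j *
         (ln (rho (tnth lam j)) - ln (tnth pi j)))
    + (1 - nu) * MSE x (mixture f lam) (f k) <=
  MSE_hat x y (f k) + beta / n%:R * (ln (rho 1) - ln (tnth pi k)).
Proof.
move=> b0 spi pik [slam lam_min].
have QE l : simplex l -> (forall j, tnth pi j = 0 -> tnth l j = 0) ->
    Q x f rho pi nu beta y l = ((1 - nu) * MSE_hat x y (mixture f l)
    + nu * (\sum_(j < M) tnth l j * MSE_hat x y (f j))
    + beta / n%:R * (\sum_(j < M) tnth l j *
         (ln (rho (tnth l j)) - ln (tnth pi j))))%:E.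
  by move=> sl suppl; rewrite /Q (K_rhoE rho_ge sl spi suppl) -EFinM -EFinD.
have kP j : tnth pi j = 0 -> (j == k)%:R = 0 :> R.
  by move=> pj; case: eqP => // jk; rewrite -jk pj ltxx in pik.
have supp j : tnth pi j = 0 -> tnth lam j = 0.
  apply: (K_rho_fin_supp rho_ge slam spi) => //.
  have s1 : simplex (segment lam k 1) by apply: segment_simplex; rewrite ?lexx ?ler01.
  have := lam_min _ s1; rewrite (QE _ s1); last first.
    by move=> i /kP ik; rewrite tnth_segment ik; ring.
  rewrite /Q => Qle; rewrite ltNge leye_eq; apply/negP => /eqP Koo.
  by move: Qle; rewrite Koo gt0_muley ?lte_fin// addey// leye_eq.
split => //; rewrite -subr_le0.
apply: (@le0_of_le_scale _ _ ((1 - nu) * MSE x (mixture f lam) (f k))) => t t01.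
have /andP[t0 t1] := t01.
have t01' : 0 <= t <= 1 by rewrite !ltW.
have st : simplex (segment lam k t) by exact: segment_simplex.
have suppt j : tnth pi j = 0 -> tnth (segment lam k t) j = 0.
  by move=> pj; rewrite tnth_segment supp// (kP _ pj); ring.
have := lam_min _ st; rewrite (QE _ slam supp) (QE _ st suppt) lee_fin.
rewrite mixture_segment MSE_hat_segment sum_segment => opt.
have pen := penalty_segment pi k t01' slam.
have := le_trans opt (lerD (lexx _) (ler_wpM2l (ltW b0) pen)).
set B := beta / _; set D := MSE _ _ _; set G := MSE_hat _ _ (mixture _ _).
set H := MSE_hat _ _ (f k); set S := \sum_(_ < _) _; set K := \sum_(_ < _) _.
move=> le_t; rewrite -(ler_pM2l t0) -subr_le0.
rewrite -subr_le0 in le_t; apply: le_trans le_t.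
by rewrite le_eqVlt; apply/orP; left; apply/eqP; ring.
Qed.

End optimality.

(** * From the empirical risk to the true risk *)

(** The bias-variance identity. *)
Lemma weighted_sqr_dist (R : realType) (I : finType) (lam a : I -> R) (y : R) :
  \sum_j lam j = 1 ->
  \sum_j lam j * (y - a j) ^+ 2 =
  (y - \sum_j lam j * a j) ^+ 2 +
  \sum_j lam j * (a j - \sum_j lam j * a j) ^+ 2.
Proof.
move=> lam1; set g := \sum_j lam j * a j.
have E z : \sum_j lam j * (z - a j) ^+ 2 =
    z ^+ 2 - 2 * z * g + \sum_j lam j * a j ^+ 2.
  transitivity (\sum_j (z ^+ 2 * lam j - 2 * z * (lam j * a j) +
      lam j * a j ^+ 2)).
    by apply: eq_bigr => j _; ring.
  by rewrite big_split/= sumrB -!mulr_sumr lam1 mulr1.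
under [X in _ = _ + X]eq_bigr do rewrite -sqrrN opprB.
by rewrite !E; ring.
Qed.

(** With [V] the variance of [a] under [lam], the right-hand side exceeds the
    left-hand side by exactly [(nu - m) * V + (1 - nu - m) * (g - a k) ^+ 2].
    The bias-variance identity around [a k] splits the offset
    [\sum_j lam_j * (a j - a k) ^+ 2] into [V], paid for by the second term on
    the right, and [(g - a k) ^+ 2], paid for by the third. *)
Lemma pointwise_contrast (R : realType) (I : finType) (lam a : I -> R)
    (k : I) (nu m e xi g : R) :
  (forall j, 0 <= lam j) -> \sum_j lam j = 1 -> m <= nu -> m <= 1 - nu ->
  g = \sum_j lam j * a j ->
  (e - g) ^+ 2 - (e - a k) ^+ 2 -
    \sum_j lam j * (2 * xi * (a j - a k) - m * (a j - a k) ^+ 2) <=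
  (1 - nu) * (e + xi - g) ^+ 2 + nu * (\sum_j lam j * (e + xi - a j) ^+ 2)
    + (1 - nu) * (g - a k) ^+ 2 - (e + xi - a k) ^+ 2.
Proof.
move=> lam0 lam1 mnu m1nu gE.
set V := \sum_j lam j * (a j - g) ^+ 2.
have V0 : 0 <= V by apply: sumr_ge0 => j _; rewrite mulr_ge0// sqr_ge0.
have -> : \sum_j lam j * (2 * xi * (a j - a k) - m * (a j - a k) ^+ 2) =
    2 * xi * (g - a k) - m * ((a k - g) ^+ 2 + V).
  rewrite /V gE -weighted_sqr_dist//.
  transitivity (\sum_j (2 * xi * (lam j * a j) - 2 * xi * a k * lam j -
      m * (lam j * (a k - a j) ^+ 2))).
    by apply: eq_bigr => j _; ring.
  by rewrite !sumrB -!mulr_sumr lam1; ring.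
rewrite weighted_sqr_dist// -gE -/V.
have h1 : 0 <= (nu - m) * V by rewrite mulr_ge0// subr_ge0.
have h2 : 0 <= (1 - nu - m) * (g - a k) ^+ 2.
  by rewrite mulr_ge0 ?sqr_ge0// subr_ge0.
rewrite -subr_ge0; apply: le_trans (addr_ge0 h1 h2) _.
by rewrite le_eqVlt; apply/orP; left; apply/eqP; ring.
Qed.

(** The noise in the comparison of [f_j] with [f_k], minus an offset
    proportional to their squared distance. *)
Definition contrast (R : realType) (X : Type) (n M : nat) (x : 'I_n -> X)
    (f : 'I_M -> X -> R) (m : R) (k : 'I_M) (xi : 'I_n -> R) (j : 'I_M) : R :=
  \sum_(i < n) (2 * xi i * (f j (x i) - f k (x i))
                - m * (f j (x i) - f k (x i)) ^+ 2).

Definition exp_contrast (R : realType) (X : Type) (n M : nat) (x : 'I_n -> X)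
    (f : 'I_M -> X -> R) (pi : M.-tuple R) (m beta : R) (k : 'I_M)
    (xi : 'I_n -> R) : R :=
  \sum_(j < M) tnth pi j * expR (contrast x f m k xi j / beta).

Section oracle.
Context (R : realType) (X : Type) (n M : nat) (x : 'I_n -> X).
Context (f : 'I_M -> X -> R) (eta : X -> R) (rho : R -> R).
Context (rho_ge : forall t : R, 0 <= t <= 1 -> t <= rho t).
Context (rho_convex : convex_function (`[0, 1]%classic : set R)
  (fun t : R => t * ln (rho t))).
Implicit Types (lam pi : M.-tuple R).

(** The average over the design points of [pointwise_contrast]. *)
Lemma MSE_contrast (nu m : R) (xi : 'I_n -> R) lam k :
  simplex lam -> m <= nu -> m <= 1 - nu ->
  forall y, y = [tuple eta (x i) + xi i | i < n] ->
  MSE x eta (mixture f lam) - MSE x eta (f k) -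
    n%:R^-1 * (\sum_(j < M) tnth lam j * contrast x f m k xi j) <=
  (1 - nu) * MSE_hat x y (mixture f lam)
    + nu * (\sum_(j < M) tnth lam j * MSE_hat x y (f j))
    + (1 - nu) * MSE x (mixture f lam) (f k) - MSE_hat x y (f k).
Proof.
move=> [lam0 lam1] mnu m1nu y yE0.
have -> : \sum_(j < M) tnth lam j * MSE_hat x y (f j) =
    n%:R^-1 * \sum_(i < n) \sum_(j < M)
      tnth lam j * (eta (x i) + xi i - f j (x i)) ^+ 2.
  rewrite exchange_big/= mulr_sumr; apply: eq_bigr => j _.
  rewrite /MSE_hat mulrCA mulr_sumr; congr (_ * _).
  by apply: eq_bigr => i _; rewrite yE0 tnth_mktuple.
have -> : \sum_(j < M) tnth lam j * contrast x f m k xi j =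
    \sum_(i < n) \sum_(j < M) tnth lam j *
      (2 * xi i * (f j (x i) - f k (x i)) - m * (f j (x i) - f k (x i)) ^+ 2).
  by rewrite exchange_big/=; apply: eq_bigr => j _; rewrite mulr_sumr.
have yE (g : X -> R) : MSE_hat x y g =
    n%:R^-1 * \sum_(i < n) (eta (x i) + xi i - g (x i)) ^+ 2.
  by rewrite /MSE_hat yE0; under eq_bigr do rewrite tnth_mktuple.
rewrite !yE /MSE ![_ * (_^-1 * _)]mulrCA -!mulrBr -!mulrDr -mulrBr.
rewrite ler_wpM2l ?invr_ge0// !mulr_sumr -!sumrB -!big_split -sumrB/=.
apply: ler_sum => i _.
exact: (pointwise_contrast (a := fun j => f j (x i)) k (eta (x i)) (xi i)
  lam0 lam1 mnu m1nu erefl).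
Qed.

(** Deterministic for each realization [xi] of the noise. The constant [c] is
    that of [gibbs_variational]: [c = 0] suits expectations and
    [c = - ln delta] the event [exp_contrast <= delta^-1]. *)
Lemma oracle_inequality pi (nu beta m c : R) (xi : 'I_n -> R) lam k :
  let y := [tuple eta (x i) + xi i | i < n] in
  (0 < n)%N -> 0 < beta -> m <= nu -> m <= 1 - nu ->
  simplex pi -> 0 < tnth pi k ->
  argmin (@simplex R M) (Q x f rho pi nu beta y) lam ->
  MSE x eta (mixture f lam) <=
  MSE x eta (f k) + beta / n%:R *
    (ln (rho 1) - ln (tnth pi k) +
     (c + expR (- c) * exp_contrast x f pi m beta k xi - 1)).
Proof.
move=> y n0 b0 mnu m1nu spi pik lam_min.
have bn0 : 0 < beta / n%:R by rewrite divr_gt0// ltr0n.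
have [supp opt] := argmin_first_order rho_ge rho_convex bn0 spi pik lam_min.
have slam := lam_min.1.
have con := MSE_contrast k slam mnu m1nu (erefl y).
have gib := gibbs_variational (fun j => contrast x f m k xi j / beta) c
  slam.1 slam.2 spi.1 supp.
set Z := c + _ - 1 in gib *.
have Krho : \sum_(j < M) tnth lam j * (ln (tnth lam j) - ln (tnth pi j)) <=
    \sum_(j < M) tnth lam j * (ln (rho (tnth lam j)) - ln (tnth pi j)).
  apply: ler_sum => j _.
  have [->|l0] := eqVneq (tnth lam j) 0; first by rewrite !mul0r.
  have lpos : 0 < tnth lam j by rewrite lt_neqAle eq_sym l0 slam.1.
  have lrho : tnth lam j <= rho (tnth lam j).
    by rewrite rho_ge// ltW//= simplex_le1.
  by rewrite ler_wpM2l ?(ltW lpos)// lerB// ler_ln ?posrE// (lt_le_trans lpos).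
set K := \sum_(j < M) tnth lam j * (ln (rho _) - _) in opt Krho.
set K' := \sum_(j < M) _ in Krho.
set U := \sum_(j < M) tnth lam j * contrast _ _ _ _ _ _ in con.
have gib' : U / beta - K' <= Z.
  rewrite (le_trans _ gib)// le_eqVlt; apply/orP; left; apply/eqP.
  rewrite mulr_suml -sumrB; apply: eq_bigr => j _; by rewrite [RHS]mulrBr mulrA.
have Ule : n%:R^-1 * U <= beta / n%:R * (Z + K).
  rewrite [beta / _]mulrC -mulrA ler_wpM2l ?invr_ge0//.
  rewrite mulrC -ler_pdivrMr//. lra.
move: con opt Ule; rewrite -/y !mulrDr.
set B := beta / _; lra.
Qed.

Lemma exp_contrast_ge0 pi (m beta : R) k xi :
  simplex pi -> 0 <= exp_contrast x f pi m beta k xi.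
Proof. by move=> [pi0 _]; apply: sumr_ge0 => j _; rewrite mulr_ge0// expR_ge0. Qed.
End oracle.

(** * The exponential moment of the contrast *)

Section moments.
Context (R : realType) (d : measure_display) (T : measurableType d).
Context (P : probability T R).
Context (X : Type) (n M : nat) (x : 'I_n -> X) (f : 'I_M -> X -> R).

Lemma measurable_expR_contrast (xi : 'I_n -> {RV P >-> R}) (m beta : R)
    (k j : 'I_M) :
  measurable_fun setT (fun w => expR (contrast x f m k (xi ^~ w) j / beta)).
Proof.
apply: measurableT_comp => //; apply: measurable_funM => //.
apply: measurable_sum => i; apply: measurable_funB => //.
by apply: measurable_funM => //; apply: measurable_funM.
Qed.

Lemma measurable_exp_contrast (xi : 'I_n -> {RV P >-> R}) (pi : M.-tuple R)
    (m beta : R) (k : 'I_M) :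
  measurable_fun setT (fun w => exp_contrast x f pi m beta k (xi ^~ w)).
Proof.
apply: measurable_sum => j; apply: measurable_funM => //.
exact: measurable_expR_contrast.
Qed.

(** With [D] the squared distance of [f_j] and [f_k] over the design points, the
    sub-Gaussian bound at [t_i = 2 * df i / beta] gives the exponent
    [2 * v * D / beta ^+ 2], which the offset [m * D / beta] compensates. *)
Lemma expR_contrast_le1 (xi : 'I_n -> {RV P >-> R}) (v m beta : R)
    (k j : 'I_M) :
  sub_gaussian xi v -> 0 < beta -> 2 * v <= m * beta ->
  (\int[P]_w (expR (contrast x f m k (xi ^~ w) j / beta))%:E <= 1)%E.
Proof.
move=> subG b0 vm.
pose df i := f j (x i) - f k (x i).
pose D := \sum_(i < n) df i ^+ 2.
have D0 : 0 <= D by apply: sumr_ge0 => i _; rewrite sqr_ge0.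
have b1 : beta != 0 by rewrite gt_eqF.
have cE w : contrast x f m k (xi ^~ w) j / beta =
    - (m / beta * D) + \sum_(i < n) (2 / beta * df i) * xi i w.
  rewrite /contrast mulr_suml /D mulr_sumr -sumrN -big_split/=.
  by apply: eq_bigr => i _; rewrite /df; field.
under eq_integral do rewrite cE expRD EFinM.
rewrite ge0_integralZl ?lee_fin ?expR_ge0//; last first.
  apply/measurable_EFinP; apply: measurableT_comp => //.
  by apply: measurable_sum => i; apply: measurable_funM.
have := subG (fun i => 2 / beta * df i); rewrite unlock => subG'.
rewrite (le_trans (lee_wpmul2l _ subG')) ?lee_fin ?expR_ge0//.
rewrite -expRD -[leRHS]expR0 ler_expR.
have -> : \sum_(i < n) (2 / beta * df i) ^+ 2 = 4 / beta ^+ 2 * D.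
  by rewrite /D mulr_sumr; apply: eq_bigr => i _; field.
have -> : - (m / beta * D) + v * (4 / beta ^+ 2 * D) / 2 =
    (2 * v - m * beta) * (D / beta ^+ 2) by field.
by rewrite mulr_le0_ge0// ?subr_le0// divr_ge0// sqr_ge0.
Qed.

Lemma expectation_exp_contrast_le1 (xi : 'I_n -> {RV P >-> R}) (v m beta : R)
    (pi : M.-tuple R) (k : 'I_M) :
  sub_gaussian xi v -> 0 < beta -> 2 * v <= m * beta -> simplex pi ->
  (\int[P]_w (exp_contrast x f pi m beta k (xi ^~ w))%:E <= 1)%E.
Proof.
move=> subG b0 vm [pi0 pi1].
have mexp j := measurable_expR_contrast xi m beta k j.
rewrite /exp_contrast; under eq_integral do rewrite -sumEFin.
rewrite ge0_integral_sum//; last 2 first.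
- by move=> j; apply/measurable_EFinP; apply: measurable_funM.
- by move=> j w _; rewrite lee_fin mulr_ge0// expR_ge0.
rewrite -[leRHS]/(1%R%:E) -pi1 -sumEFin; apply: lee_sum => j _.
under eq_integral do rewrite EFinM.
rewrite ge0_integralZl ?lee_fin//; last exact/measurable_EFinP.
rewrite -[leRHS]mule1 lee_wpmul2l ?lee_fin//.
exact: expR_contrast_le1 vm.
Qed.

End moments.

Lemma markov_le1 (R : realType) (d : measure_display) (T : measurableType d)
    (P : probability T R) (S : T -> R) (delta : R) :
  measurable_fun setT S -> (forall w, 0 <= S w) -> 0 < delta ->
  (\int[P]_w (S w)%:E <= 1)%E ->
  ((1 - delta)%:E <= P [set w | (S w <= delta^-1)%R]%classic)%E.
Proof.
move=> mS S0 d0 ES.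
have mA : measurable [set w | (S w <= delta^-1)%R]%classic.
  by rewrite -[X in measurable X]setTI; exact: measurable_fun_le.
rewrite -[X in P X]setCK probability_setC; last exact: measurableC.
rewrite EFinB leeB//.
rewrite -(setIT (~` _)) -integral_indic//; last exact: measurableC.
apply: (@le_trans _ _ (\int[P]_w (delta%:E * (S w)%:E))%E).
  apply: ge0_le_integral => //.
  - apply/measurable_EFinP; apply: measurable_indic; exact: measurableC.
  - by apply/measurable_EFinP; apply: measurable_funM.
  - move=> w _; rewrite -EFinM lee_fin indicE.
    have [|_] := boolP (w \in _); last by rewrite mulr_ge0// ltW.
    rewrite inE/= => /negP; rewrite -ltNge => /ltW Sd.
    by rewrite -(ler_pM2l d0) divff ?gt_eqF in Sd.
rewrite ge0_integralZl ?lee_fin ?(ltW d0)//; last 2 first.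
- exact/measurable_EFinP.
- by move=> w _; rewrite lee_fin.
by rewrite -[leRHS]mule1 lee_wpmul2l// lee_fin ltW.
Qed.

(** * The estimator *)

Lemma measurable_MSE_mixture (R : realType) (d : measure_display)
    (T : measurableType d) (X : Type) (n M : nat) (x : 'I_n -> X)
    (f : 'I_M -> X -> R) (eta : X -> R) (lam : T -> M.-tuple R) :
  measurable_fun setT lam ->
  measurable_fun setT (fun w => MSE x eta (mixture f (lam w))).
Proof.
move=> mlam; apply: measurable_funM => //.
apply: measurable_sum => i; apply: measurable_funX => //.
apply: measurable_funB => //; apply: measurable_sum => j.
apply: measurable_funM => //.
exact: (measurableT_comp (measurable_tnth j) mlam).
Qed.

Lemma measurable_observations (R : realType) (d : measure_display)
    (T : measurableType d) (P : probability T R) (X : Type) (n : nat)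
    (x : 'I_n -> X) (eta : X -> R) (xi : 'I_n -> {RV P >-> R}) :
  measurable_fun setT (observations x eta xi).
Proof.
apply/measurable_fun_tnthP => i.
rewrite (_ : _ \o _ = fun w => eta (x i) + xi i w).
  exact: measurable_funD.
by apply/funext => w /=; rewrite tnth_mktuple.
Qed.

Theorem corollary3p1
    (R : realType) (d : measure_display) (T : measurableType d)
    (P : probability T R)
    (X : Type) (n M : nat) (n_gt0 : (0 < n)%N)
    (x : 'I_n -> X) (f : 'I_M -> X -> R) (eta : X -> R)
    (rho : R -> R)
    (rho_ge : forall t : R, 0 <= t <= 1 -> t <= rho t)
    (rho_convex : convex_function (`[0, 1] : set R)
       (fun t : R => t * ln (rho t)))
    (nu : R) (nu01 : 0 < nu < 1)
    (pi : M.-tuple R) (pi_simplex : simplex pi)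
    (xi : 'I_n -> {RV P >-> R}) (sigma : R) (sigma_gt0 : 0 < sigma ^+ 2)
    (xi_indep : mutually_independent xi)
    (xi_subG : forall i : 'I_n,
       sub_gaussian (fun _ : 'I_1 => xi i) (sigma ^+ 2))
    (beta : R) (beta_ge : 2 * sigma ^+ 2 / Num.min nu (1 - nu) <= beta)
    (lamt : n.-tuple R -> M.-tuple R)
    (lamt_meas : measurable_fun [set: n.-tuple R] lamt)
    (lamt_argmin : forall w : T,
       argmin (@simplex R M) (Q x f rho pi nu beta (observations x eta xi w))
         (lamt (observations x eta xi w))) :
  (forall delta : R, 0 < delta < 1 ->
    ((1 - delta)%:E <=
     P [set w : T | (MSE x eta (mixture f (lamt (observations x eta xi w))))%:E <=
          \big[Order.min/+oo]_(j < M)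
            ((MSE x eta (f j))%:E +
             (beta / n%:R)%:E *
               lne ((rho 1)%:E / (tnth pi j * delta)%:E))]%classic)%E) /\
  ('E_P[fun w => MSE x eta (mixture f (lamt (observations x eta xi w)))] <=
   \big[Order.min/+oo]_(j < M)
     ((MSE x eta (f j))%:E +
      (beta / n%:R)%:E * lne ((rho 1)%:E / (tnth pi j)%:E)))%E.
Proof.
set Y := observations x eta xi.
pose m := Num.min nu (1 - nu).
have /andP[nu0 nu1] := nu01.
have m0 : 0 < m by rewrite lt_min nu0 subr_gt0.
have mnu : m <= nu by rewrite ge_min lexx.
have m1nu : m <= 1 - nu by rewrite ge_min lexx orbT.
have vm : 2 * sigma ^+ 2 <= m * beta.
  by rewrite [m * _]mulrC -ler_pdivrMr.
have b0 : 0 < beta.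
  by rewrite (lt_le_trans _ beta_ge)// divr_gt0// mulr_gt0.
have bn0 : 0 < beta / n%:R by rewrite divr_gt0// ltr0n.
have rho1 : 0 < rho 1 by rewrite (lt_le_trans ltr01)// rho_ge// ler01 lexx.
have subG := sub_gaussian_indep xi_indep xi_subG.
pose S k w := exp_contrast x f pi m beta k (xi ^~ w).
have mS k : measurable_fun setT (S k) by exact: measurable_exp_contrast.
have S0 k w : 0 <= S k w by exact: exp_contrast_ge0.
have ES k : (\int[P]_w (S k w)%:E <= 1)%E.
  exact: expectation_exp_contrast_le1 subG b0 vm pi_simplex.
have mMSE : measurable_fun setT (fun w => MSE x eta (mixture f (lamt (Y w)))).
  apply: measurable_MSE_mixture; apply: measurableT_comp lamt_meas _.
  exact: measurable_observations.
have oracle w k c : 0 < tnth pi k ->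
    MSE x eta (mixture f (lamt (Y w))) <= MSE x eta (f k) + beta / n%:R *
      (ln (rho 1) - ln (tnth pi k) + (c + expR (- c) * S k w - 1)).
  move=> pik.
  exact: (oracle_inequality rho_ge rho_convex c n_gt0 b0 mnu m1nu pi_simplex pik
    (lamt_argmin w)).
have pi_gt0 k : tnth pi k != 0 -> 0 < tnth pi k.
  by move=> pik; rewrite lt_neqAle eq_sym pik pi_simplex.1.
have bound_y k : ((MSE x eta (f k))%:E +
    (beta / n%:R)%:E * lne ((rho 1)%:E / 0%:E) = +oo)%E.
  by rewrite inve0 gt0_muley ?lte_fin//= gt0_muley ?lte_fin.
split.
- move=> delta /andP[d0 d1].
  set B := \big[_/_]_(_ < _) _.
  set E := [set w | _]%classic.
  have mE : measurable E.
    rewrite -[E]setTI; apply: measurable_lee => //.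
    exact/measurable_EFinP.
  (* No index with a finite bound: the event is the whole space. *)
  have ETP : B = +oo%E -> ((1 - delta)%:E <= P E)%E.
    move=> By; rewrite (_ : E = setT) ?probability_setT ?lee_fin ?gerBl ?ltW//.
    by apply/seteqP; split => // w _; rewrite /E/= By leey.
  have := lexx B; rewrite {1}/B => /bigmin_leP[/=|[k _ kB]].
    by rewrite leye_eq => /eqP /ETP.
  have [pk0|/pi_gt0 pik] := eqVneq (tnth pi k) 0.
    by apply: ETP; apply/eqP; rewrite -leye_eq -[leLHS](bound_y k) -(mul0r delta) -pk0.
  apply: le_trans (markov_le1 (mS k) (S0 k) d0 (ES k)) _.
  apply: le_measure; rewrite ?inE//.
    by rewrite -[X in measurable X]setTI; exact: measurable_fun_le.
  move=> w /= Sd; apply: le_trans kB.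
  rewrite lne_ratio// ?mulr_gt0// -EFinM -EFinD lee_fin.
  apply: le_trans (oracle w k (- ln delta) pik) _.
  rewrite lerD2l ler_wpM2l ?(ltW bn0)// lnM ?posrE// opprK lnK ?posrE//.
  have : delta * S k w <= 1 by rewrite -(divff (lt0r_neq0 d0)) ler_wpM2l// ltW.
  lra.
- apply/bigmin_geP; split => [|k _]; first exact: leey.
  have [->|/pi_gt0 pik] := eqVneq (tnth pi k) 0; first by rewrite bound_y leey.
  rewrite lne_ratio// -EFinM -EFinD.
  set A := MSE x eta (f k) + _.
  have A0 : 0 <= A.
    rewrite addr_ge0//.
      by rewrite mulr_ge0 ?invr_ge0// sumr_ge0// => i _; exact: sqr_ge0.
    rewrite mulr_ge0 ?(ltW bn0)// subr_ge0 ler_ln ?posrE//.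
    by rewrite (le_trans (simplex_le1 k pi_simplex))// rho_ge// ler01 lexx.
  (* The bound [MSE + beta / n <= A + beta / n * S] is the oracle inequality at
     c = 0 rearranged so that both sides are nonnegative. *)
  rewrite unlock -(@leeD2rE _ (beta / n%:R)%:E)//.
  have MSE0 w : 0 <= MSE x eta (mixture f (lamt (Y w))).
    by rewrite mulr_ge0 ?invr_ge0// sumr_ge0// => i _; exact: sqr_ge0.
  have cstE (r : R) : (\int[P]_w r%:E = r%:E)%E.
    by rewrite integral_cst//= probability_setT mule1.
  rewrite -[in leLHS](cstE (beta / n%:R)) -ge0_integralD//; last 3 first.
  - by move=> w _; rewrite lee_fin.
  - exact/measurable_EFinP.
  - by move=> w _; rewrite lee_fin ltW.
  apply: (@le_trans _ _ (\int[P]_w (A%:E + (beta / n%:R)%:E * (S k w)%:E))%E).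
    apply: ge0_le_integral => //.
    - by move=> w _; rewrite -EFinD lee_fin addr_ge0// ltW.
    - apply/measurable_EFinP; exact: measurable_funD.
    - apply/measurable_EFinP; apply: measurable_funD => //.
      exact: measurable_funM.
    - move=> w _; rewrite -EFinM -!EFinD lee_fin.
      have := oracle w k 0 pik; rewrite oppr0 expR0 mul1r add0r.
      by rewrite /A mulrDr; lra.
  rewrite ge0_integralD//; last 2 first.
  - by move=> w _; rewrite mule_ge0 ?lee_fin// ltW.
  - by apply/measurable_EFinP; exact: measurable_funM.
  rewrite cstE leeD2l// ge0_integralZl ?lee_fin ?(ltW bn0)//; last 2 first.
  - exact/measurable_EFinP.
  - by move=> w _; rewrite lee_fin.
  by rewrite -[leRHS]mule1 lee_wpmul2l// lee_fin ltW.
Qed.
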